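(* Let $G$ and $H$ be finite simple connected graphs that are not complete graphs. Then the graph $G\boxtimes H$ has no extreme vertices (with respect to toll convexity).
   Context: The strong product $G\boxtimes H$ has vertex set $V(G)\times V(H)$; $(g_1,h_1)$ and $(g_2,h_2)$ are adjacent iff ($g_1g_2\in E(G)$ and $h_1=h_2$) or ($g_1=g_2$ and $h_1h_2\in E(H)$) or ($g_1g_2\in E(G)$ and $h_1h_2\in E(H)$). For two different non-adjacent vertices $u,v$ of a graph $F$, a tolled walk between $u$ and $v$ is a sequence of vertices $u,w_1,\dots,w_k,v$ with $k\ge 1$ such that consecutive vertices of $w_1,\dots,w_k$ are adjacent, $uw_i\in E(F)$ if and only if $i=1$, and $vw_i\in E(F)$ if and only if $i=k$. If $uv\in E(F)$, the only tolled walk between $u$ and $v$ is $u,v$; the only tolled walk from $v$ to itself is the single vertex $v$. The toll interval $T_F(u,v)$ is the set of all vertices of $F$ lying on some tolled walk between $u$ and $v$. A set $S\subseteq V(F)$ is toll convex if $T_F(u,v)\subseteq S$ for all $u,v\in S$. A vertex $s$ is an extreme vertex of $F$ if $V(F)\setminus\{s\}$ is toll convex. *)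

(* Defs.v *)
From HB Require Import structures.
From mathcomp Require Import all_boot.

Set Implicit Arguments.
Unset Strict Implicit.
Unset Printing Implicit Defensive.

Record sgraph := SGraph {
  vertex :> finType;
  edge : rel vertex;
  edge_sym : symmetric edge;
  edge_irrefl : irreflexive edge
}.

Arguments edge {s} _ _.
Notation "x -- y" := (edge x y) (at level 30, no associativity).

Definition connected_graph (G : sgraph) : Prop :=
  0 < #|G| /\ forall x y : G, connect edge x y.

Definition complete_graph (G : sgraph) : Prop :=
  forall x y : G, x != y -> x -- y.

Section StrongProduct.
Variables G H : sgraph.

Definition strong_rel : rel (G * H) := fun x y =>
  [|| (x.1 -- y.1) && (x.2 == y.2),
      (x.1 == y.1) && (x.2 -- y.2)
    | (x.1 -- y.1) && (x.2 -- y.2)].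

Lemma strong_rel_sym : symmetric strong_rel.
Proof.
move=> x y; rewrite /strong_rel !(edge_sym y.1) !(edge_sym y.2).
by rewrite !(eq_sym y.1) !(eq_sym y.2).
Qed.

Lemma strong_rel_irrefl : irreflexive strong_rel.
Proof. by move=> x; rewrite /strong_rel !edge_irrefl andbF. Qed.

Definition strong_product : sgraph :=
  SGraph strong_rel_sym strong_rel_irrefl.

End StrongProduct.

Notation "G ⊠ H" := (strong_product G H) (at level 40, left associativity).

Section Toll.
Variable F : sgraph.
Implicit Types (u v s x : F) (p w : seq F) (S : {set F}).

(* [w] lists w_1, ..., w_k, stored from position 0. Repetitions are allowed: *)
(* the two equivalences range over positions of [w], not over its elements.  *)
Definition tolled_interior u v w : Prop :=
  [/\ 1 <= size w,
      sorted edge w,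
      forall i, i < size w -> u -- nth u w i <-> i = 0
    & forall i, i < size w -> v -- nth v w i <-> i = (size w).-1].

Definition tolled_walk u v p : Prop :=
  if u == v then p = [:: v]
  else if u -- v then p = [:: u; v]
  else exists2 w, tolled_interior u v w & p = u :: rcons w v.

Definition toll_interval u v : F -> Prop :=
  fun x => exists2 p, tolled_walk u v p & x \in p.

Definition toll_convex S : Prop :=
  forall u v, u \in S -> v \in S -> forall x, toll_interval u v x -> x \in S.

Definition extreme_vertex s : Prop := toll_convex [set~ s].

End Toll.

(* Main.v *)
(* If [g] has two distinct non-adjacent neighbours [x], [y], then            *)
(* [(x, h), (g, h), (y, h)] is a tolled walk through [(g, h)]; likewise for   *)
(* [h].  Otherwise [g] and [h] start induced paths [g, a, c] and [h, b, d],   *)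
(* and [(g, d), (g, b), (g, h), (a, h), (c, h)] is a tolled walk.             *)

Require Import Defs.
From mathcomp Require Import all_boot.

(** A vertex is not extreme once a tolled walk between two other vertices passes through it
    ([not_extreme_tolled]). By [neighbors_or_induced_path], either a coordinate of [(g, h)] has two
    non-adjacent neighbours, which lift to the product with the other coordinate fixed, or both
    coordinates start induced paths. These are joined into an L with corner [(g, h)]; each end is
    kept away from the opposite arm by one coordinate alone. *)

(** If no induced path of length two starts at [g], connectedness makes [g] adjacent to all other
    vertices, so any non-adjacent pair lies among its neighbours. *)
Lemma neighbors_or_induced_path {G : sgraph} (g : G) :
  connected_graph G -> ~ complete_graph G ->
  (exists x y : G, [/\ x -- g, g -- y, x != y & ~~ x -- y]) \/
  (exists a c : G, [/\ g -- a, a -- c, g != c & ~~ g -- c]).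
Proof.
move=> [_ conG] ncG.
have [/existsP[a /existsP[c /and4P[]]]|noP] :=
    boolP [exists a : G, exists c : G, [&& g -- a, a -- c, g != c & ~~ g -- c]].
  by right; exists a, c.
left.
have adjg z : z != g -> g -- z.
  (* An edge [x -- y] leaving the closed neighbourhood of [g] would yield the excluded path
     [g, x, y]. *)
  have clN : closed edge [pred t | (t == g) || g -- t].
    apply: intro_closed => [x y|x y xy]; first exact/sym_connect_sym/edge_sym.
    rewrite !inE => /orP[/eqP xg|gx]; first by rewrite -xg xy orbT.
    apply: contraR noP; rewrite negb_or eq_sym => /andP[gy ngy].
    by apply/existsP; exists x; apply/existsP; exists y; apply/and4P.
  move=> zg; have := closed_connect clN (conG g z).
  by rewrite !inE eqxx (negPf zg) /= => <-.
have [/existsP[x /existsP[y /andP[xy nxy]]]|/existsPn noNE] :=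
    boolP [exists x : G, exists y : G, (x != y) && ~~ x -- y]; last first.
  case: ncG => x y xy; apply: contraT => nxy.
  by have /existsPn/(_ y) := noNE x; rewrite xy nxy.
(* [g] is adjacent to everything else, so it cannot belong to a non-adjacent pair. *)
have xg : x != g by apply: contraNneq nxy => xg; rewrite xg adjg // -xg eq_sym.
have yg : y != g by apply: contraNneq nxy => ->; rewrite edge_sym adjg.
by exists x, y; split; rewrite ?adjg // edge_sym adjg.
Qed.

Lemma not_extreme_tolled (F : sgraph) (s u v : F) (w : seq F) :
  u != v -> ~~ u -- v -> u != s -> v != s -> tolled_interior u v w ->
  s \in w -> ~ extreme_vertex s.
Proof.
move=> uv nuv us vs tw sw ext.
suff: s \in [set~ s] by rewrite !inE eqxx.
apply: (ext u v); rewrite ?inE //.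
exists (u :: rcons w v); first by rewrite /tolled_walk (negPf uv) (negPf nuv); exists w.
by rewrite inE mem_rcons inE sw !orbT.
Qed.

Lemma not_extreme_neighbors (F : sgraph) (s u v : F) :
  u -- s -> s -- v -> u != v -> ~~ u -- v -> ~ extreme_vertex s.
Proof.
move=> us sv uv nuv; apply: (not_extreme_tolled _ _ u v [:: s]) => //.
- by apply: contraTneq us => ->; rewrite edge_irrefl.
- by apply: contraTneq sv => ->; rewrite edge_irrefl.
- by split=> // -[|i] //= _; rewrite ?us // edge_sym sv.
- exact: mem_head.
Qed.

Theorem theorem3p10 (G H : sgraph)
  (connG : connected_graph G) (connH : connected_graph H)
  (ncG : ~ complete_graph G) (ncH : ~ complete_graph H) :
  forall s : G ⊠ H, ~ extreme_vertex s.
Proof.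
case=> g h.
have [[x [y [xg gy xy nxy]]]|[a [c [ga ac gc ngc]]]] :=
    neighbors_or_induced_path g connG ncG.
  apply: (not_extreme_neighbors (G ⊠ H) _ (x, h) (y, h)).
  - by rewrite /= /strong_rel /= xg eqxx.
  - by rewrite /= /strong_rel /= gy eqxx.
  - by rewrite xpair_eqE negb_and xy.
  - by rewrite /= /strong_rel /= (negPf nxy) (negPf xy).
have [[x [y [xh hy xy nxy]]]|[b [d [hb bd hd nhd]]]] :=
    neighbors_or_induced_path h connH ncH.
  apply: (not_extreme_neighbors (G ⊠ H) _ (g, x) (g, y)).
  - by rewrite /= /strong_rel /= xh eqxx orbT.
  - by rewrite /= /strong_rel /= hy eqxx orbT.
  - by rewrite xpair_eqE negb_and xy orbT.
  - by rewrite /= /strong_rel /= (negPf nxy) (negPf xy) !andbF.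
have ngE : (c -- g = false) * (g -- c = false) * (c == g = false) * (g == c = false).
  by rewrite (edge_sym c) (eq_sym c) (negPf gc) (negPf ngc).
have nhE : (d -- h = false) * (h -- d = false) * (d == h = false) * (h == d = false).
  by rewrite (edge_sym d) (eq_sym d) (negPf hd) (negPf nhd).
apply: (not_extreme_tolled (G ⊠ H) _ (g, d) (c, h)
          [:: (g, b) : G ⊠ H; (g, h); (a, h)]).
- by rewrite xpair_eqE ngE.
- by rewrite /= /strong_rel /= !ngE.
- by rewrite xpair_eqE nhE andbF.
- by rewrite xpair_eqE ngE.
- split=> //=.
  + by rewrite /strong_rel /= !eqxx (edge_sym b) hb ga !orbT.
  (* Second coordinates [d], [h] separate [(g, d)] from all but [(g, b)]; below, first coordinates
     [c], [g] separate [(c, h)] from all but [(a, h)]. *)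
  + move=> [|[|[|i]]] //= _; rewrite /strong_rel /= ?nhE ?andbF //=.
    by rewrite eqxx (edge_sym d) bd orbT.
  + move=> [|[|[|i]]] //= _; rewrite /strong_rel /= ?ngE ?andbF //=.
    by rewrite eqxx (edge_sym c) ac.
- by rewrite !inE eqxx orbT.
Qed.
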